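(* Let $b>3$ be an integer. If $n$ is a prime that is a pandigital number in base $b$, then $$n\ge \frac{b^b-b^2+b-1}{(b-1)^2}+b^b.$$ If $n$ is a prime that is a penholodigital number in base $b$, then $$n\ge \frac{b^b-b^2+b-1}{(b-1)^2}+b^{b-1}.$$
   Context: Numbers are written in base $b$ without leading zeros, with digits $0,1,\dots,b-1$. A positive integer $N$ is a pandigital number in base $b$ if its base-$b$ representation contains each of the $b$ digits $0,1,\dots,b-1$ at least once. $N$ is a penholodigital number in base $b$ if its base-$b$ representation does not contain the digit $0$ and contains each of the $b-1$ nonzero digits $1,\dots,b-1$ at least once. *)

(* Defs.v *)
From mathcomp Require Import all_boot.

Set Implicit Arguments.
Unset Strict Implicit.
Unset Printing Implicit Defensive.

(* Digits of n in base b, least significant first.  For 1 < b and 0 < n,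
   trunc_log b n is the exponent k with b ^ k <= n < b ^ k.+1, so there are
   exactly k.+1 digits and no leading zero. *)
Definition digits (b n : nat) : seq nat :=
  [seq n %/ b ^ i %% b | i <- iota 0 (trunc_log b n).+1].

Definition pandigital (b n : nat) : Prop :=
  0 < n /\ forall d, d < b -> d \in digits b n.

Definition penholodigital (b n : nat) : Prop :=
  [/\ 0 < n, 0 \notin digits b n & forall d, 0 < d < b -> d \in digits b n].

Lemma digits_ltn (b n d : nat) : 1 < b -> d \in digits b n -> d < b.
Proof. by move=> b_gt1 /mapP[i _ ->]; rewrite ltn_mod ltnW. Qed.

Lemma digits_sum (b n : nat) : 1 < b ->
  n = \sum_(i < size (digits b n)) nth 0 (digits b n) i * b ^ i.
Proof.
move=> b_gt1; rewrite size_map size_iota.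
under eq_bigr => i _ do rewrite (nth_map 0) ?size_iota // nth_iota //= add0n.
suff sumE k : \sum_(i < k) n %/ b ^ i %% b * b ^ i = n %% b ^ k.
  by rewrite sumE modn_small // trunc_log_ltn.
elim: k => [|k IHk]; first by rewrite big_ord0 expn0 modn1.
rewrite big_ord_recr IHk /= [RHS](divn_eq _ (b ^ k)) expnS -modn_divl.
by rewrite modn_dvdm ?dvdn_mull // addnC.
Qed.

Lemma digits_last (b n : nat) : 1 < b -> 0 < n -> 0 < last 0 (digits b n).
Proof.
move=> b_gt1 n_gt0; rewrite -nth_last size_map size_iota /=.
rewrite (nth_map 0) ?size_iota // nth_iota // add0n.
have b_gt0 : 0 < b by exact: ltnW.
rewrite modn_small ?divn_gt0 ?expn_gt0 ?b_gt0 ?trunc_logP //.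
by rewrite ltn_divLR ?expn_gt0 ?b_gt0 // -expnS trunc_log_ltn.
Qed.

(* Main.v *)
Require Import Defs.
From mathcomp Require Import all_boot all_order all_algebra.
From mathcomp Require Import zify ring.
Import Order.TTheory GRing.Theory Num.Theory.

Set Implicit Arguments.
Unset Strict Implicit.
Unset Printing Implicit Defensive.

(** Two observations give the bound. First, [n] is congruent to its digit sum
    modulo [b - 1]; if every nonzero digit occurred exactly once, this sum
    would be [b (b - 1) / 2], and [b - 1] (for even [b]) or [(b - 1) / 2] (for
    odd [b]) would be a proper divisor of [n]. So at least [b] of the digits
    are nonzero. Second, a digit [d] is the number of [j] with [j < d], so a
    number is the sum over [j] of the 0/1-digit numbers marking the positions
    whose digit exceeds [j]; each of these is at least the repunit of the same
    weight. For a leading digit 1 the remaining digits include at least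
    [b - 1 - j] digits exceeding [j], and the sum of the repunits of lengths
    [b - 1 - j] is [123...(b-1)] in base [b], that is,
    [(b ^ b - b ^ 2 + b - 1) / (b - 1) ^ 2]. *)

Definition horner_digits (b : nat) (s : seq nat) : nat :=
  foldr (fun d v => d + b * v) 0 s.

Lemma horner_digitsE (b : nat) (s : seq nat) :
  horner_digits b s = \sum_(i < size s) nth 0 s i * b ^ i.
Proof.
elim: s => [|d s IHs] /=; first by rewrite big_ord0.
rewrite IHs big_ord_recl /= muln1 big_distrr; congr (_ + _).
by apply: eq_bigr => i _; rewrite /bump expnS /= mulnCA.
Qed.

Lemma horner_digits_rcons (b : nat) (s : seq nat) (d : nat) :
  horner_digits b (rcons s d) = horner_digits b s + d * b ^ size s.
Proof.
elim: s => [|x s IHs] /=; first by rewrite muln0 addn0 muln1.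
by rewrite IHs expnS; ring.
Qed.

Lemma horner_digits_mod (b : nat) (s : seq nat) :
  0 < b -> horner_digits b s = sumn s %[mod b.-1].
Proof.
case: b => // a _; elim: s => //= d s IHs.
by rewrite mulSn addnA addnC mulnC modnMDl -modnDmr IHs modnDmr.
Qed.

Definition repunit (b c : nat) : nat := \sum_(i < c) b ^ i.

Lemma repunitS (b c : nat) : repunit b c.+1 = 1 + b * repunit b c.
Proof.
rewrite /repunit big_ord_recl big_distrr /=; congr (_ + _).
by apply: eq_bigr => i _; rewrite /bump expnS.
Qed.

Lemma leq_repunit (b c c' : nat) : c <= c' -> repunit b c <= repunit b c'.
Proof.
by move=> /subnKC <-; rewrite /repunit big_split_ord /= leq_addr.
Qed.

(** Induction from the lowest digit [d]: a term with [j < d] becomes [1 + b * repunit b c], any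
    other grows at most by the factor [b], and at most [d] indices gain the 1. *)
Lemma sum_repunit_le (b m : nat) (s : seq nat) : 0 < b ->
  \sum_(j < m) repunit b (count (ltn j) s) <= horner_digits b s.
Proof.
move=> b_gt0; elim: s => [|d s IHs] /=.
  by rewrite big1 // => j _; rewrite /repunit big_ord0.
have dE : \sum_(j < m) (j < d) <= d.
  elim: {IHs} m => [|m IHm]; first by rewrite big_ord0.
  case: (leqP m d) => [le_md|lt_dm]; last first.
    by rewrite big_ord_recr /= ltnNge (ltnW lt_dm) addn0.
  rewrite big_ord_recr /=; case: (ltnP m d) => [lt_md|_]; last by rewrite addn0.
  rewrite addn1 (leq_ltn_trans _ lt_md) //.
  rewrite -[leqRHS]card_ord -sum1_card; apply: leq_sum => j _; exact: leq_b1.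
rewrite (leq_trans _ (leq_add dE (leq_mul (leqnn b) IHs))) //.
rewrite big_distrr -big_split /=; apply: leq_sum => j _.
by case: (j < d); rewrite /= ?repunitS ?add0n ?leq_pmull.
Qed.

(** Division-free closed form for base [a.+1]; at [m = a] it is the fraction of the theorem. *)
Lemma sum_repunitE (a m : nat) :
  (\sum_(j < m) repunit a.+1 (m - j)) * a ^ 2 + (m.+1 * a).+1 = a.+1 ^ m.+1.
Proof.
elim: m => [|m IHm]; first by rewrite big_ord0 mul1n.
rewrite big_ord_recl subn0 mulnDl [RHS]expnS.
have /= E := predn_exp a.+1 m.+1.
rewrite -/(repunit _ _) in E.
have := expn_gt0 a.+1 m.+1; rewrite orTb.
rewrite (eq_bigr (fun j : 'I_m => repunit a.+1 (m - j))); last first.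
  by move=> j _; rewrite /= /bump subSS.
move: IHm E; set S := \sum_(_ < _) _; set q := _ ^ m.+1; set r := repunit _ _.
move=> <-{q} E _; have -> : r * a ^ 2 = a * (a * r) by ring.
by rewrite -E !addnS /=; ring.
Qed.

(** Makes twice the leading power a sufficient lower bound. With [b = a.+1], it follows from the
    closed form and [a.+1 <= a ^ 2]. *)
Lemma sum_repunit_leq_exp (b : nat) : 2 < b ->
  \sum_(j < b.-1) repunit b (b.-1 - j) <= b ^ b.-1.
Proof.
case: b => // a a_gt1 /=.
have a_gt0 : 0 < a by exact: ltnW.
rewrite -(@leq_pmul2r (a ^ 2)) ?expn_gt0 ?a_gt0 //.
apply: leq_trans (leq_addr (a.+1 * a).+1 _) _.
by rewrite sum_repunitE expnSr leq_mul2l; apply/orP; right; nia.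
Qed.

Lemma size_digits (b n : nat) : size (digits b n) = (trunc_log b n).+1.
Proof. by rewrite size_map size_iota. Qed.

Lemma horner_digitsK (b n : nat) : 1 < b -> horner_digits b (digits b n) = n.
Proof. by move=> b_gt1; rewrite horner_digitsE -digits_sum. Qed.

Lemma leq_exp_size_digits (b n k : nat) :
  1 < b -> 0 < n -> k < size (digits b n) -> b ^ k <= n.
Proof.
move=> b_gt1 n_gt0; rewrite size_digits ltnS => le_k.
by apply: leq_trans (trunc_logP b_gt1 n_gt0); rewrite leq_exp2l.
Qed.

Lemma sumn_filter_gt0 (s : seq nat) : sumn [seq d <- s | 0 < d] = sumn s.
Proof. by elim: s => //= -[|d] s /= ->. Qed.

Lemma sumn_iota1 (b : nat) : sumn (iota 1 b.-1) * 2 = b * b.-1.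
Proof.
case: b => // a; rewrite /= sumnE; elim: a => [|a IHa]; first by rewrite big_nil.
by rewrite -{1}(addn1 a) iotaD big_cat big_seq1 mulnDl IHa /=; ring.
Qed.

Lemma prime_nonzero_digits (b n : nat) : 3 < b -> prime n ->
  (forall d, 0 < d < b -> d \in digits b n) ->
  b <= count (ltn 0) (digits b n).
Proof.
move=> b_gt3 n_pr digP; rewrite leqNgt; apply/negP => few.
have b_gt1 : 1 < b by exact: ltn_trans b_gt3.
(* With fewer than [b] nonzero digits, [t] has no room for repetitions: it is a permutation of
   [iota 1 b.-1]. *)
set t := [seq d <- digits b n | 0 < d].
have sub_t : {subset iota 1 b.-1 <= t}.
  move=> d; rewrite mem_iota add1n prednK; last exact: ltnW.
  by move=> dP; rewrite mem_filter digP // andbT; case/andP: dP.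
have size_t : size t <= size (iota 1 b.-1).
  by rewrite size_filter size_iota -ltnS prednK // ltnW.
have [t_size t_mem] := uniq_min_size (iota_uniq 1 b.-1) sub_t size_t.
have t_uniq : uniq t by rewrite -(eq_uniq t_size t_mem) iota_uniq.
have sumE : sumn (digits b n) * 2 = b * b.-1.
  rewrite -sumn_iota1 -sumn_filter_gt0 (@perm_sumn _ (iota 1 b.-1)) //.
  by apply: uniq_perm; rewrite ?iota_uniq // => d; rewrite t_mem.
have lt_bn : b <= n.
  rewrite -[b]expn1 leq_exp_size_digits ?prime_gt0 //.
  rewrite (leq_trans _ (count_size (ltn 0) _)) // -size_filter -/t -t_size.
  by rewrite size_iota; case: (b) b_gt3 => [|[|[|]]].
(* Such an [e] divides [n] by the digit-sum congruence, and [e < b <= n] makes it a proper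
   divisor. *)
have no_dvd e : 1 < e < b -> e %| b.-1 -> e %| sumn (digits b n) -> False.
  case/andP=> e_gt1 e_lt e_dvd; rewrite /dvdn -(modn_dvdm _ e_dvd).
  rewrite -horner_digits_mod ?(ltnW b_gt1) // horner_digitsK //.
  rewrite modn_dvdm // -/(e %| n) => e_dvdn; have /primeP[_ ndiv] := n_pr.
  by have /orP[] := ndiv e e_dvdn; lia.
have [odd_b|even_b] := boolP (odd b.-1).
  apply: (no_dvd b.-1); rewrite ?dvdnn //; first by lia.
  by rewrite -(@Gauss_dvdl _ _ 2) ?coprimen2 // sumE dvdn_mull.
have bE : b.-1 = (b.-1)./2 * 2 by rewrite muln2 even_halfK.
(* Here [b] is odd, so [3 < b] forces [5 <= b] and the half exceeds 1. *)
apply: (no_dvd (b.-1)./2); first by lia.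
  by rewrite {2}bE dvdn_mulr.
have /eqP := sumE; rewrite {1}bE mulnA eqn_pmul2r // => /eqP->.
exact: dvdn_mull.
Qed.

(** Serves both claims: [k = b] for pandigital and [k = b.-1] for penholodigital numbers. *)
Lemma prime_nonzero_digits_geq (b n k : nat) : 3 < b -> prime n ->
  (forall d, 0 < d < b -> d \in digits b n) ->
  b.-1 <= k < size (digits b n) ->
  \sum_(j < b.-1) repunit b (b.-1 - j) + b ^ k <= n.
Proof.
move=> b_gt3 n_pr digP /andP[le_bk lt_k].
have b_gt1 : 1 < b by exact: ltn_trans b_gt3.
have b_gt0 : 0 < b by exact: ltnW.
have n_gt0 := prime_gt0 n_pr.
have le_M : \sum_(j < b.-1) repunit b (b.-1 - j) <= b ^ k.
  by rewrite (leq_trans (sum_repunit_leq_exp (ltnW b_gt3))) ?leq_exp2l.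
have cnt := prime_nonzero_digits b_gt3 n_pr digP.
(* By [le_M], [2 * b ^ k <= n] is enough; an extra digit, or a leading digit above 1, gives this. *)
have [k1_lt|] := ltnP k.+1 (size (digits b n)).
  rewrite (leq_trans _ (leq_exp_size_digits b_gt1 n_gt0 k1_lt)) //.
  by rewrite expnS; nia.
move=> size_le; have := horner_digitsK n b_gt1; have := digits_last b_gt1 n_gt0.
case/lastP: (digits b n) digP lt_k cnt size_le => // r x digP.
rewrite last_rcons size_rcons ltnS => le_kr cnt le_rk x_gt0.
have kE : size r = k by apply/eqP; rewrite eqn_leq le_kr andbT.
rewrite horner_digits_rcons kE => <-.
have [x_gt1|x_le1] := ltnP 1 x; first by nia.
have {x_le1 x_gt0} xE : x = 1 by lia.
rewrite xE mul1n leq_add2r (leq_trans _ (sum_repunit_le b.-1 r b_gt0)) //.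
apply: leq_sum => j _; apply: leq_repunit.
move: cnt; rewrite -cats1 count_cat /= xE !addn0 addn1 => cnt.
(* For [j = 0] the digit 1 may be missing from [r], so the count of nonzero digits is needed. For
   larger [j], the digits above [j] differ from the leading 1 and all lie in [r]. *)
case: j => -[|j] j_lt /=; first by rewrite subn0; lia.
rewrite -size_filter -(size_iota j.+2 (b.-1 - j.+1)).
apply: uniq_leq_size (iota_uniq _ _) _ => d; rewrite mem_iota => dP.
have := digP d; rewrite mem_rcons inE mem_filter xE /=.
by case: (d \in r) => //; lia.
Qed.

Lemma sum_repunit_rat (b : nat) : (1 < b)%N ->
  ((b%:R ^+ b - b%:R ^+ 2 + b%:R - 1) / (b%:R - 1) ^+ 2)%R
    = (\sum_(j < b.-1) repunit b (b.-1 - j))%:R%R :> rat.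
Proof.
case: b => // a a_gt0 /=.
have : (\sum_(j < a) repunit a.+1 (a - j)) * a ^ 2 + a.+1 * a + 1 = a.+1 ^ a.+1.
  by rewrite addn1 -addnS sum_repunitE.
move=> /(congr1 (GRing.natmul (1 : rat)%R)).
rewrite [in RHS]natrX => <-; rewrite 2!natrD natrM natrX natrM -!natr1.
have : (a%:R != 0 :> rat)%R by rewrite pnatr_eq0 -lt0n.
set S := (\sum_(_ < _) _)%:R%R; move: S (a%:R)%R => S x x0; field.
by rewrite addrK.
Qed.

Local Open Scope ring_scope.

Theorem theorem5 (b : nat) (hb : (3 < b)%N) (n : nat) (hn : prime n) :
  (pandigital b n ->
     n%:R >= (b%:R ^+ b - b%:R ^+ 2 + b%:R - 1) / (b%:R - 1) ^+ 2
               + b%:R ^+ b :> rat) /\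
  (penholodigital b n ->
     n%:R >= (b%:R ^+ b - b%:R ^+ 2 + b%:R - 1) / (b%:R - 1) ^+ 2
               + b%:R ^+ b.-1 :> rat).
Proof.
have b_gt1 : (1 < b)%N by exact: ltn_trans hb.
rewrite sum_repunit_rat // -!natrX -!natrD !ler_nat.
split=> [[_ digP]|[_ _ digP]]; apply: prime_nonzero_digits_geq => //.
- by move=> d /andP[_]; apply: digP.
- have digP' d : (0 < d < b)%N -> d \in digits b n by case/andP=> _; apply: digP.
  rewrite leq_pred (leq_ltn_trans (prime_nonzero_digits hb hn digP')) //.
  (* The digit 0 joins the [b] nonzero ones, giving at least [b.+1] digits. *)
  have has0 : has (predC (ltn 0)) (digits b n).
    by apply/hasP; exists 0%N => //; apply: digP; apply: ltnW.
  by rewrite -(count_predC (ltn 0)) -addn1 leq_add2l -has_count.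
- rewrite leqnn prednK ?(ltnW b_gt1) //.
  exact: leq_trans (prime_nonzero_digits hb hn digP) (count_size _ _).
Qed.
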